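(* Assume Conditions (C1) and (C2) below, let $c>0$ and $0<\tau<1/2$ be constants, and assume (C3): $\min_{j\in\mathcal M}\omega_j\ge 2cN^{-\tau}$. Let $k=\max\{k_1,\dots,k_s\}\le n$ and take the threshold $\gamma=cN^{-\tau}$, and set $\widetilde{\mathcal M}=\{j:\widetilde\omega_j\ge\gamma,\ 1\le j\le p\}$. Then there is a constant $\eta>0$ (not depending on $N,m,n,p$) such that $$ P\big(\mathcal M\subseteq\widetilde{\mathcal M}\big)\ge 1-\eta\, d\,\big(1-N^{-2\tau}/\eta\big)^{m\lfloor n/k\rfloor}, $$ where $d$ is the cardinality of $\mathcal M$.
   Context: Let $(Y_i,\mathbf X_i)$, $i=1,\dots,N$, be i.i.d. copies of $(Y,\mathbf X)$, with $Y$ a real response with support $\Phi_y$ and $\mathbf X=(X_1,\dots,X_p)^T$; write $X_{ij}$ for the $j$-th entry of $\mathbf X_i$ and $Z_{ij}=(Y_i,X_{ij})$. $\mathcal M\subseteq\{1,\dots,p\}$ is the set of relevant features: $j\in\mathcal M$ iff the conditional distribution function $F(y\mid\mathbf X)$ functionally depends on $X_j$ for some $y\in\Phi_y$. The index set $\{1,\dots,N\}$ is partitioned into $m$ disjoint sets $\mathcal S_1,\dots,\mathcal S_m$, each of size $n=N/m$. For each $j$ and $h=1,\dots,s$, $\theta_{j,h}$ is a real component parameter and $\hat\theta_{j,h}(z_1,\dots,z_{k_h})$ is a symmetric measurable kernel of degree $k_h$ with $E\,\hat\theta_{j,h}(Z_{i_1j},\dots,Z_{i_{k_h}j})=\theta_{j,h}$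 for distinct indices. The local U-statistic is $U^l_{j,h}=\binom{n}{k_h}^{-1}\sum_{\{i_1,\dots,i_{k_h}\}\subseteq\mathcal S_l}\hat\theta_{j,h}(Z_{i_1j},\dots,Z_{i_{k_h}j})$, $\bar U_{j,h}=\frac1m\sum_{l=1}^mU^l_{j,h}$, $\omega_j=g(\theta_{j,1},\dots,\theta_{j,s})$ for a fixed function $g$, and $\widetilde\omega_j=g(\bar U_{j,1},\dots,\bar U_{j,s})$. Condition (C1): there exist constants $\kappa_0>0$ and $K<\infty$ with $E\exp\{\kappa_0|\hat\theta_{j,h}(Z_{1j},\dots,Z_{k_hj})|\}\le K$ for all $j,h$. Condition (C2): $g$ is given by a fixed finite expression built from its arguments using addition, subtraction, multiplication, division, absolute value and square root; there are constants $a,b>0$ such that, for every $j$, $|\theta_{j,h}|\le a$ for all $h$, every subexpression of $g$ used as a denominator has absolute value at least $b$ at $(\theta_{j,1},\dots,\theta_{j,s})$, and every subexpression under a square root has value at least $b$ there. *)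

(* Defs.v *)
From HB Require Import structures.
From mathcomp Require Import all_boot all_order all_algebra perm.
From mathcomp Require Import all_classical all_reals all_analysis.

Set Implicit Arguments.
Unset Strict Implicit.
Unset Printing Implicit Defensive.

Import Order.TTheory GRing.Theory Num.Theory.
Local Open Scope classical_set_scope.
Local Open Scope ring_scope.

Inductive gexpr (s : nat) : Type :=
| GVar of 'I_s
| GAdd of gexpr s & gexpr s
| GSub of gexpr s & gexpr s
| GMul of gexpr s & gexpr s
| GDiv of gexpr s & gexpr s
| GAbs of gexpr s
| GSqrt of gexpr s.

Section GExpr.
Variables (R : realType) (s : nat).

Fixpoint geval (e : gexpr s) (v : 'I_s -> R) : R :=
  match e with
  | GVar i => v i
  | GAdd e1 e2 => geval e1 v + geval e2 v
  | GSub e1 e2 => geval e1 v - geval e2 v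
  | GMul e1 e2 => geval e1 v * geval e2 v
  | GDiv e1 e2 => geval e1 v / geval e2 v
  | GAbs e1 => `|geval e1 v|
  | GSqrt e1 => Num.sqrt (geval e1 v)
  end.

Fixpoint gwell (b : R) (e : gexpr s) (v : 'I_s -> R) : Prop :=
  match e with
  | GVar _ => True
  | GAdd e1 e2 => gwell b e1 v /\ gwell b e2 v
  | GSub e1 e2 => gwell b e1 v /\ gwell b e2 v
  | GMul e1 e2 => gwell b e1 v /\ gwell b e2 v
  | GDiv e1 e2 => [/\ gwell b e1 v, gwell b e2 v & b <= `|geval e2 v|]
  | GAbs e1 => gwell b e1 v
  | GSqrt e1 => gwell b e1 v /\ b <= geval e1 v
  end.
End GExpr.

Section Prob.
Context {R : realType} {d : measure_display} {Omega : measurableType d}.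
Variable P : probability Omega R.

Definition mutually_independent {dT} {T : measurableType dT} (N : nat)
    (W : 'I_N -> Omega -> T) : Prop :=
  forall B : 'I_N -> set T, (forall i, measurable (B i)) ->
    P (\bigcap_(i in [set: 'I_N]) (W i @^-1` B i)) =
    \big[*%E/1%E]_(i < N) P (W i @^-1` B i).

Definition same_law {dT} {T : measurableType dT} (V W : Omega -> T) : Prop :=
  forall B : set T, measurable B -> P (V @^-1` B) = P (W @^-1` B).

Definition in_support (Y : Omega -> R) (y : R) : Prop :=
  forall e : R, 0 < e -> (0 < P [set w | (`|Y w - y| < e)%R])%E.

Definition cond_cdf_version (p : nat) (Y : Omega -> R) (X : Omega -> p.-tuple R)
    (y : R) (G : p.-tuple R -> R) : Prop :=
  measurable_fun setT G /\
  forall B : set (p.-tuple R), measurable B ->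
    P ([set w | Y w <= y] `&` (X @^-1` B)) =
    (\int[P]_(w in X @^-1` B) (G (X w))%:E)%E.

Definition free_of (p : nat) (j : 'I_p) (G : p.-tuple R -> R) : Prop :=
  forall x x' : p.-tuple R,
    (forall i, i != j -> tnth x i = tnth x' i) -> G x = G x'.

(* j is a relevant feature: for some y in the support of Y, F(y | X)
   functionally depends on X_j (no version of it is free of X_j) *)
Definition relevant (p : nat) (Y : Omega -> R) (X : Omega -> p.-tuple R)
    (j : 'I_p) : Prop :=
  exists y, in_support Y y /\
    ~ (exists G, cond_cdf_version Y X y G /\ free_of j G).
End Prob.

Definition strict_incr (k N : nat) (f : {ffun 'I_k -> 'I_N}) : bool :=
  [forall t1 : 'I_k, forall t2 : 'I_k, (t1 < t2)%N ==> (f t1 < f t2)%N].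

Definition symmetric_kernel {T : Type} {R : Type} (k : nat)
    (th : k.-tuple T -> R) : Prop :=
  forall (z : k.-tuple T) (sigma : {perm 'I_k}),
    th [tuple tnth z (sigma t) | t < k] = th z.

Section UStat.
Context {R : realType} {d : measure_display} {Omega : measurableType d}.
Variables (N m n p : nat) (Y : 'I_N -> Omega -> R) (X : 'I_N -> Omega -> p.-tuple R).

Definition Zobs (i : 'I_N) (j : 'I_p) (w : Omega) : R * R := (Y i w, tnth (X i w) j).

(* local U-statistic over the block S_l = [set i | blk i == l] *)
Definition local_U (blk : 'I_N -> 'I_m) (k : nat)
    (th : k.-tuple (R * R) -> R) (j : 'I_p) (l : 'I_m) (w : Omega) : R :=
  ('C(n, k)%:R)^-1 *
  \sum_(f : {ffun 'I_k -> 'I_N} | strict_incr f && [forall t, blk (f t) == l])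
     th [tuple Zobs (f t) j w | t < k].

Definition avg_U (blk : 'I_N -> 'I_m) (k : nat)
    (th : k.-tuple (R * R) -> R) (j : 'I_p) (w : Omega) : R :=
  (m%:R)^-1 * \sum_(l < m) local_U blk th j l w.
End UStat.

(* Main.v *)
Require Import Defs.
From HB Require Import structures.
From mathcomp Require Import all_boot all_order all_algebra perm.
From mathcomp Require Import all_classical all_reals all_analysis.
From mathcomp Require Import fingroup measurable_realfun ring lra.

Set Implicit Arguments.
Unset Strict Implicit.
Unset Printing Implicit Defensive.

Import Order.TTheory GRing.Theory Num.Theory.
Local Open Scope classical_set_scope.
Local Open Scope ring_scope.

(** The averaged U-statistic is a mean, over the permutations of the positions
    inside a block, of averages of [m * (n %/ k)] kernel values at disjoint tuples
    of observations (Hoeffding's decomposition).  Jensen's inequality and the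
    independence of the disjoint tuples reduce its moment generating function to
    that of one centred kernel value, which (C1) bounds by [1 + C t^2] near 0;
    Chernoff's inequality then gives the tail [2 (1 - e^2 / (8 C))^(m * (n %/ k))]
    for deviations [e].  By (C2), [g] is Lipschitz near the parameters, uniformly
    in [j], so a failure at [j] forces a deviation of order [N^(-tau)] of one of
    the [s] components, and a union bound concludes. *)

(** * Algebraic expressions *)

(** All components are cut by the largest degree [k], so the kernels of smaller degree also get
    [n %/ k] tuples per block and share one exponent. Jensen has to precede independence: tuples
    that belong to different permutations overlap, and only those of one fixed permutation are
    disjoint. The target is a power of [1 - x], whereas Chernoff produces [expR (- x)], which is at
    least [1 - x]; giving up half of the exponent [e^2 / (4 C)] repairs this and explains the 8.
    Since [eta] is fixed before the sample, the Lipschitz constants of [g] come by induction on the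
    expression from [a] and [b] alone, and every smallness condition on deviations is absorbed in a
    factor [delta], valid for all [N] because [N^(-tau) <= 1]. *)

Lemma measurable_invr (R : realType) : measurable_fun [set: R] (fun x : R => x^-1).
Proof.
(* Real powers are measurable in their base, and squaring makes the base nonnegative. At 0 both
   sides vanish, since [0^-1 = 0]. *)
have -> : (fun x : R => x^-1) = (fun x => x * (x ^+ 2) `^ (-1)).
  apply/funext => x; rewrite powR_inv1 ?sqr_ge0//.
  have [->|x0] := eqVneq x 0; first by rewrite invr0 mul0r.
  by rewrite expr2 invfM mulrA mulfV// mul1r.
apply: measurable_funM => //.
by apply: (@measurableT_comp _ _ _ _ _ _ (@powR R ^~ (-1))).
Qed.

Lemma measurable_geval (R : realType) (d : measure_display)
    (T : measurableType d) (s : nat) (g : gexpr s) (v : T -> 'I_s -> R) :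
  (forall i, measurable_fun setT (fun x => v x i)) ->
  measurable_fun setT (fun x => geval g (v x)).
Proof.
move=> mv; elim: g => /= [i|f mf g mg|f mf g mg|f mf g mg|f mf g mg|f mf|f mf].
- exact: mv.
- exact: measurable_funD.
- exact: measurable_funB.
- exact: measurable_funM.
- apply: measurable_funM => //.
  exact: (measurableT_comp (@measurable_invr R)).
- exact: measurableT_comp.
- apply: (@measurableT_comp _ _ _ _ _ _ (@Num.sqrt R)) => //.
  by apply: continuous_measurable_fun; exact: sqrt_continuous.
Qed.

(** The numerator is split as [(x' - x) * y - x * (y' - y)], so only size bounds at the reference
    point [(x, y)] enter. Moving [y] by at most [b / 2] leaves [b / 2] below the new denominator,
    hence the factor 2. *)
Lemma ler_norm_divB {R : realType} (x y x' y' A1 A2 e1 e2 b : R) :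
  0 < b -> `|x| <= A1 -> `|y| <= A2 -> b <= `|y| ->
  `|x' - x| <= e1 -> `|y' - y| <= e2 -> e2 <= b / 2 ->
  `|x' / y' - x / y| <= 2 * (e1 * A2 + A1 * e2) / b ^+ 2.
Proof.
move=> b0 xA yA yb xe ye eb.
have y'b : b / 2 <= `|y'|.
  have := ler_normD (y - y') y'; rewrite subrK => h.
  by move: ye; rewrite distrC => ye; lra.
have y0 : y != 0 by rewrite -normr_gt0; lra.
have y'0 : y' != 0 by rewrite -normr_gt0; lra.
have -> : x' / y' - x / y = ((x' - x) * y - x * (y' - y)) / (y' * y).
  by field; rewrite y0 y'0.
rewrite normrM normfV normrM ler_pdivrMr ?mulr_gt0 ?normr_gt0//.
apply: (@le_trans _ _ (e1 * A2 + A1 * e2)).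
  apply: (le_trans (ler_normB _ _)); rewrite !normrM.
  by apply: lerD; apply: ler_pM.
have e10 : 0 <= e1 by rewrite (le_trans _ xe).
have e20 : 0 <= e2 by rewrite (le_trans _ ye).
have A10 : 0 <= A1 by rewrite (le_trans _ xA).
have A20 : 0 <= A2 by rewrite (le_trans _ yA).
have h : b / 2 * b <= `|y'| * `|y| by apply: ler_pM => //; lra.
rewrite [leRHS](_ : _ = (e1 * A2 + A1 * e2) * (2 * (`|y'| * `|y|) / b ^+ 2)).
  rewrite ler_peMr ?addr_ge0 ?mulr_ge0// ler_pdivlMr ?exprn_gt0//.
  by rewrite expr2; lra.
by ring.
Qed.

(** [y' - y] is the difference of the roots times their sum, and the sum is at least the root of
    [b]. The cap on [e] keeps [y'] nonnegative, so that its root squares back to it. *)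
Lemma ler_norm_sqrtB {R : realType} (y y' e b : R) :
  0 < b -> b <= y -> `|y' - y| <= e -> e <= b / 2 ->
  `|Num.sqrt y' - Num.sqrt y| <= e / Num.sqrt b.
Proof.
move=> b0 yb ye eb.
have y'0 : 0 <= y' by have := ler_norm (y - y'); rewrite distrC; lra.
have y0 : 0 <= y by lra.
rewrite ler_pdivlMr ?sqrtr_gt0//.
apply: (le_trans _ ye).
have -> : y' - y = (Num.sqrt y' - Num.sqrt y) * (Num.sqrt y' + Num.sqrt y).
  by rewrite -subr_sqr !sqr_sqrtr.
rewrite normrM ler_wpM2l// ger0_norm ?addr_ge0 ?sqrtr_ge0//.
by rewrite (le_trans (ler_wsqrtr yb))// lerDr sqrtr_ge0.
Qed.

(** The size bound [A] travels with the Lipschitz bound because products and quotients need it. All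
    constants precede [v] and [th], so they serve every feature at once. *)
Lemma geval_lipschitz (R : realType) (s : nat) (g : gexpr s) (a b : R) :
  0 < a -> 0 < b -> exists A L delta : R, [/\ 0 < A, 0 < L, 0 < delta &
    forall (v th : 'I_s -> R) (e : R), 0 <= e -> e <= delta ->
      (forall h, `|th h| <= a) -> gwell b g th ->
      (forall h, `|v h - th h| <= e) ->
      `|geval g th| <= A /\ `|geval g v - geval g th| <= L * e].
Proof.
move=> a0 b0.
elim: g => /= [i|||||g [A1 [L1 [d1 [A10 L10 d10 IH1]]]]|g [A1 [L1 [d1 [A10 L10 d10 IH1]]]]];
  try move=> g1 [A1 [L1 [d1 [A10 L10 d10 IH1]]]] g2 [A2 [L2 [d2 [A20 L20 d20 IH2]]]].
- exists a, 1, 1; split => // v th e e0 e1 tha _ vth.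
  by rewrite mul1r; split.
- exists (A1 + A2), (L1 + L2), (Num.min d1 d2).
  split; rewrite ?addr_gt0 ?lt_min ?d10//.
  move=> v th e e0; rewrite le_min => /andP[ed1 ed2] tha [w1 w2] vth.
  have [h1 h2] := IH1 v th e e0 ed1 tha w1 vth.
  have [h3 h4] := IH2 v th e e0 ed2 tha w2 vth.
  split; first exact: (le_trans (ler_normD _ _) (lerD h1 h3)).
  rewrite opprD addrACA mulrDl.
  exact: (le_trans (ler_normD _ _) (lerD h2 h4)).
- exists (A1 + A2), (L1 + L2), (Num.min d1 d2).
  split; rewrite ?addr_gt0 ?lt_min ?d10//.
  move=> v th e e0; rewrite le_min => /andP[ed1 ed2] tha [w1 w2] vth.
  have [h1 h2] := IH1 v th e e0 ed1 tha w1 vth.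
  have [h3 h4] := IH2 v th e e0 ed2 tha w2 vth.
  split; first exact: (le_trans (ler_normB _ _) (lerD h1 h3)).
  rewrite opprD addrACA -opprD mulrDl.
  exact: (le_trans (ler_normB _ _) (lerD h2 h4)).
(* The cap 1 on the deviation bounds the perturbed second factor by [A2 + L2]. *)
- exists (A1 * A2), (L1 * (A2 + L2) + A1 * L2), (Num.min (Num.min d1 d2) 1).
  split; rewrite ?mulr_gt0 ?addr_gt0 ?mulr_gt0 ?addr_gt0 ?lt_min ?d10 ?d20 ?ltr01//.
  move=> v th e e0; rewrite !le_min -andbA => /and3P[ed1 ed2 e1] tha [w1 w2] vth.
  have [h1 h2] := IH1 v th e e0 ed1 tha w1 vth.
  have [h3 h4] := IH2 v th e e0 ed2 tha w2 vth.
  split; first by rewrite normrM ler_pM.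
  set x' := geval g1 v; set x := geval g1 th; set y' := geval g2 v; set y := geval g2 th.
  have -> : x' * y' - x * y = (x' - x) * y' + x * (y' - y) by ring.
  rewrite [leRHS](_ : _ = L1 * e * (A2 + L2) + A1 * (L2 * e)); last by ring.
  apply: (le_trans (ler_normD _ _)).
  apply: lerD; rewrite normrM ler_pM//.
  rewrite -[y'](subrK y) addrC; apply: (le_trans (ler_normD _ _)); apply: lerD => //.
  by apply: (le_trans h4); rewrite ler_piMr// ltW.
(* The cap [b / 2 / L2] keeps the denominator within [b / 2] of its reference value. *)
- exists (A1 / b), (2 * (L1 * A2 + A1 * L2) / b ^+ 2),
    (Num.min (Num.min d1 d2) (b / 2 / L2)).
  have p0 : 0 < b / 2 / L2 by rewrite !divr_gt0.
  split; rewrite ?divr_gt0 ?mulr_gt0 ?addr_gt0 ?mulr_gt0 ?exprn_gt0 ?lt_min ?d10 ?d20//.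
  move=> v th e e0; rewrite !le_min -andbA => /and3P[ed1 ed2 e1] tha [w1 w2 w3] vth.
  have [h1 h2] := IH1 v th e e0 ed1 tha w1 vth.
  have [h3 h4] := IH2 v th e e0 ed2 tha w2 vth.
  split.
    rewrite normrM normfV ler_pM ?invr_ge0//.
    by rewrite lef_pV2// posrE (lt_le_trans b0).
  move: e1; rewrite ler_pdivlMr// mulrC => e1.
  apply: (le_trans (ler_norm_divB b0 h1 h3 w3 h2 h4 e1)).
  rewrite le_eqVlt; apply/orP; left; apply/eqP; ring.
- exists A1, L1, d1; split => // v th e e0 ed1 tha w1 vth.
  have [h1 h2] := IH1 v th e e0 ed1 tha w1 vth.
  by rewrite normr_id; split => //; exact: (le_trans (ler_dist_dist _ _)).
- exists (Num.sqrt A1), (L1 / Num.sqrt b), (Num.min d1 (b / 2 / L1)).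
  have p0 : 0 < b / 2 / L1 by rewrite !divr_gt0.
  split; rewrite ?divr_gt0 ?sqrtr_gt0 ?lt_min ?d10//.
  move=> v th e e0; rewrite !le_min => /andP[ed1 e1] tha [w1 w3] vth.
  have [h1 h2] := IH1 v th e e0 ed1 tha w1 vth.
  split.
    by rewrite ger0_norm ?sqrtr_ge0// ler_wsqrtr// (le_trans (ler_norm _)).
  move: e1; rewrite ler_pdivlMr// mulrC => e1.
  by rewrite mulrAC; exact: ler_norm_sqrtB.
Qed.

(** * Averaging over permutations *)

Section SortingPermutation.
Variables (k N : nat).
Implicit Types (f : {ffun 'I_k -> 'I_N}) (p : {perm 'I_k}).

Definition perm_ffun f p : {ffun 'I_k -> 'I_N} := [ffun t => f (p t)].

(** Counting the smaller values recovers [t] from [f (p t)], so a sorting permutation is forced;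
    uniqueness rests on this. *)
Lemma perm_ffun_rank f p : strict_incr (perm_ffun f p) ->
  forall t, #|[set t' | (f t' < f (p t))%N]%SET| = t :> nat.
Proof.
move=> /forallP inc t.
have incE t1 t2 : (f (p t1) < f (p t2))%N = (t1 < t2)%N.
  apply/idP/idP => [|h]; last by have /forallP/(_ t2)/implyP/(_ h) := inc t1; rewrite !ffunE.
  apply: contraTT; rewrite -!leqNgt leq_eqVlt => /orP[/eqP/val_inj->//|h].
  by have /forallP/(_ t1)/implyP/(_ h) := inc t2; rewrite !ffunE => /ltnW.
rewrite -(card_imset _ (@perm_inj _ p^-1)%g).
rewrite (_ : imset _ _ = [set t' : 'I_k | (t' < t)%N]%SET).
  rewrite -sum1dep_card (big_ord_narrow (F := fun=> 1%N) (ltnW (ltn_ord t))).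
  by rewrite sum1_card card_ord.
apply/setP => u; rewrite inE -incE; apply/imsetP/idP => [[x]|h].
  by rewrite inE => ? ->; rewrite permKV.
by exists (p u); rewrite ?inE ?permK.
Qed.

(** Sending [t] to the rank of [f t] among the values is an injection of ['I_k] into itself, hence a
    permutation; its inverse sorts [f]. *)
Lemma exists_sorting_perm f : injective f -> exists p, strict_incr (perm_ffun f p).
Proof.
move=> finj.
have rk_lt t : (#|[set t' | (f t' < f t)%N]%SET| < k)%N.
  rewrite -[X in (_ < X)%N](card_ord k) -cardsT; apply: proper_card.
  by rewrite properT; apply/negP => /eqP/setP/(_ t); rewrite !inE ltnn.
pose rk t := Ordinal (rk_lt t).
have rk_mono t1 t2 : (f t1 < f t2)%N -> (rk t1 < rk t2)%N.
  move=> h; apply: proper_card; apply/properP; split.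
    by apply/fintype.subsetP => u; rewrite !inE => /ltn_trans; exact.
  by exists t1; rewrite !inE ?ltnn.
have rk_inj : injective rk.
  move=> t1 t2 /(congr1 val)/= h; apply: finj; apply: val_inj.
  by case: (ltngtP (f t1) (f t2)) => // /rk_mono; rewrite /= h ltnn.
exists (perm rk_inj)^-1%g; apply/forallP => t1; apply/forallP => t2.
apply/implyP => t12; rewrite !ffunE.
set p := (perm rk_inj)^-1%g.
have pE t : rk (p t) = t by rewrite -[LHS](permE rk_inj) permKV.
rewrite ltnNge leq_eqVlt; apply/negP => /orP[/eqP/val_inj/finj/perm_inj e|].
  by rewrite e ltnn in t12.
by move=> /rk_mono; rewrite !pE ltnNge ltnW.
Qed.

Lemma sorting_perm_uniq f p q : injective f ->
  strict_incr (perm_ffun f p) -> strict_incr (perm_ffun f q) -> p = q.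
Proof.
move=> finj /perm_ffun_rank hp /perm_ffun_rank hq.
apply: (can_inj (@invgK _)); apply/permP => u; apply: val_inj => /=.
by rewrite -[LHS]hp -[RHS]hq !permKV.
Qed.

Lemma strict_incr_inj f : strict_incr f -> injective f.
Proof.
move=> /forallP inc t1 t2 e; apply: val_inj; case: (ltngtP t1 t2) => // h.
  by have /forallP/(_ t2)/implyP/(_ h) := inc t1; rewrite e ltnn.
by have /forallP/(_ t1)/implyP/(_ h) := inc t2; rewrite e ltnn.
Qed.

(** Every injective map has exactly one sorting permutation, so a sum over it can be inserted for
    free. Once the sums are exchanged, each of the [k!] permutations contributes the full sum over
    increasing maps. Sums over subsets thus become sums over ordered tuples. *)
Lemma sum_inj_sorted (R : pzRingType) (Q : pred 'I_N)
    (phi : {ffun 'I_k -> 'I_N} -> R) :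
  (forall f p, phi (perm_ffun f p) = phi f) ->
  \sum_(f : {ffun 'I_k -> 'I_N} | injectiveb f && [forall t, Q (f t)]) phi f =
  (k`!)%:R * \sum_(f : {ffun 'I_k -> 'I_N} | strict_incr f && [forall t, Q (f t)]) phi f.
Proof.
move=> phiS.
have QE f p : [forall t, Q (perm_ffun f p t)] = [forall t, Q (f t)].
  apply/forallP/forallP => h t; last by rewrite ffunE.
  by have := h (p^-1%g t); rewrite ffunE permKV.
transitivity (\sum_(f : {ffun 'I_k -> 'I_N} | injectiveb f && [forall t, Q (f t)])
    \sum_(p : {perm 'I_k} | strict_incr (perm_ffun f p)) phi (perm_ffun f p)).
  apply: eq_bigr => f /andP[/injectiveP finj _].
  have [p0 hp0] := exists_sorting_perm finj.
  rewrite (big_pred1 p0) ?phiS// => p.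
  by apply/idP/eqP => [hp|->//]; exact: (sorting_perm_uniq finj).
rewrite (exchange_big_dep predT)//=.
rewrite (eq_bigr (fun=> \sum_(f : {ffun 'I_k -> 'I_N} |
    strict_incr f && [forall t, Q (f t)]) phi f)).
  by rewrite sumr_const card_Sn mulr_natl.
move=> p _.
have K1 : cancel (fun f => perm_ffun f p^-1%g) (fun f => perm_ffun f p).
  by move=> f; apply/ffunP => t; rewrite !ffunE permK.
have K2 : cancel (fun f => perm_ffun f p) (fun f => perm_ffun f p^-1%g).
  by move=> f; apply/ffunP => t; rewrite !ffunE permKV.
rewrite [RHS](reindex_onto (fun f => perm_ffun f p) (fun f => perm_ffun f p^-1%g))//=.
apply: eq_bigl => f; rewrite QE K2 eqxx andbT andbC andbA; congr (_ && _).
apply/andP/idP => [[]//|h]; split=> //.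
by apply/injectiveP => x y e; apply: (@perm_inj _ p^-1%g);
  apply: (strict_incr_inj h); rewrite !ffunE !permKV.
Qed.

End SortingPermutation.

(** Each induction step prescribes one more value by following [p] with a transposition; injectivity
    of [f0] and [f] keeps it off the values already set. *)
Lemma exists_perm_extending (k n : nat) (f0 f : 'I_k -> 'I_n) :
  injective f0 -> injective f -> exists p : {perm 'I_n}, forall t, p (f0 t) = f t.
Proof.
move=> f0i fi.
suff H j : (j <= k)%N -> exists p : {perm 'I_n}, forall t : 'I_k, (t < j)%N -> p (f0 t) = f t.
  by have [p hp] := H k (leqnn k); exists p => t; exact: hp.
elim: j => [_|j IH jk]; first by exists 1%g.
have [p hp] := IH (ltnW jk).
pose tj := Ordinal jk.
exists (p * tperm (p (f0 tj)) (f tj))%g => t.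
rewrite permM ltnS leq_eqVlt => /orP[/eqP tE|tj'].
  have -> : t = tj by exact: val_inj.
  by rewrite tpermL.
have tn : t != tj by rewrite -val_eqE /= neq_ltn tj'.
rewrite (hp t)// tpermD// eq_sym; last by rewrite (inj_eq fi).
by rewrite -(hp t)// (inj_eq perm_inj) (inj_eq f0i).
Qed.

Section AverageOverPermutations.
Variables (R : numFieldType) (k n N : nat) (Q : pred 'I_N).
Variables (e : 'I_n -> 'I_N) (f0 : 'I_k -> 'I_n).
Hypotheses (e_inj : injective e) (eQ : forall x, Q (e x)).
Hypotheses (Qe : forall i, Q i -> exists x, e x = i) (f0_inj : injective f0).

Let ef (p : {perm 'I_n}) : {ffun 'I_k -> 'I_N} := [ffun t => e (p (f0 t))].

(** The fibres of [ef] are cosets of the subgroup fixing the range of [f0] pointwise, so they all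
    have the same size, and every injective map into the block has a nonempty fibre. *)
Lemma sum_perm_inj (phi : {ffun 'I_k -> 'I_N} -> R) :
  \sum_(p : {perm 'I_n}) phi (ef p) =
  #|[set p : {perm 'I_n} | [forall t, p (f0 t) == f0 t]]%SET|%:R *
  \sum_(f : {ffun 'I_k -> 'I_N} | injectiveb f && [forall t, Q (f t)]) phi f.
Proof.
rewrite (partition_big ef (fun f => injectiveb f && [forall t, Q (f t)])) /=; last first.
  move=> p _; apply/andP; split; last by apply/forallP => t; rewrite ffunE.
  by apply/injectiveP => x y; rewrite !ffunE => /e_inj/perm_inj/f0_inj.
rewrite mulr_sumr; apply: eq_bigr => f /andP[/injectiveP fi /forallP fQ].
have [f' hf'] := choice (fun t => Qe (fQ t)).
have f'i : injective f' by move=> x y h; apply: fi; rewrite -!hf' h.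
have [p0 hp0] := exists_perm_extending f0_inj f'i.
rewrite (eq_bigr (fun=> phi f)) => [|p /eqP->//].
rewrite (eq_bigl (mem [set p | ef p == f]%SET)) => [|p]; last by rewrite /= inE.
rewrite sumr_const -[LHS]mulr_natl; congr (_%:R * _).
rewrite -[RHS](card_imset _ (@mulIg _ p0)); apply: eq_card => p.
apply/idP/imsetP => [|[q]].
  rewrite inE => /eqP pf; exists (p * p0^-1)%g; last by rewrite mulgKV.
  rewrite inE; apply/forallP => t; rewrite permM; apply/eqP.
  apply: (@perm_inj _ p0); rewrite permKV hp0; apply: e_inj.
  by rewrite hf' -pf ffunE.
rewrite !finset.in_set => /forallP hq ->; apply/eqP/ffunP => t.
by rewrite ffunE permM (eqP (hq t)) hp0 hf'.
Qed.

Lemma avg_sorted_avg_perm (phi : {ffun 'I_k -> 'I_N} -> R) :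
  (forall f p, phi (perm_ffun f p) = phi f) ->
  ('C(n, k)%:R)^-1 * \sum_(f : {ffun 'I_k -> 'I_N} | strict_incr f && [forall t, Q (f t)]) phi f =
  (n`!%:R)^-1 * \sum_(p : {perm 'I_n}) phi (ef p).
Proof.
move=> phiS; rewrite sum_perm_inj sum_inj_sorted//.
set A := #|_|; rewrite !mulrA; congr (_ * _).
have kn : (k <= n)%N by have := leq_card _ f0_inj; rewrite !card_ord.
(* Taking [phi = 1] counts the permutations and yields the size of the stabiliser indirectly. *)
have nE : n`!%:R = A%:R * (n ^_ k)%:R :> R.
  have := sum_perm_inj (fun=> 1); rewrite !sumr_const card_Sn => ->.
  congr (_ * _%:R); rewrite -/A.
  rewrite (_ : n ^_ k = #|Q| ^_ #|'I_k|).
    rewrite -card_inj_ffuns_on cardsE; apply: eq_card => f.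
    by rewrite !unfold_in /= andbC.
  rewrite card_ord; congr (_ ^_ _).
  rewrite -[LHS](card_ord n) -(card_imset _ e_inj); apply: eq_card => i.
  apply/imsetP/idP => [[x _ ->]|/Qe[x <-]]; [exact: eQ|by exists x].
have A0 : A%:R != 0 :> R.
  apply/negP => /eqP A0; move: nE; rewrite A0 mul0r => /eqP.
  by rewrite pnatr_eq0 -leqn0 leqNgt fact_gt0.
have k0 : (k`!)%:R != 0 :> R by rewrite pnatr_eq0 -lt0n fact_gt0.
have C0 : ('C(n, k))%:R != 0 :> R by rewrite pnatr_eq0 -lt0n bin_gt0.
by rewrite nE -bin_ffact natrM; field; rewrite A0 k0 C0.
Qed.

End AverageOverPermutations.

(** * Independence *)

Section TupleBoxes.
Context {d : measure_display} {T : measurableType d} (n : nat).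

Definition tuple_box (B : 'I_n -> set T) : set (n.-tuple T) :=
  [set x | forall t, B t (tnth x t)].

(** Measurable rectangles form a pi-system that contains the whole space and generates the product
    sigma-algebra, so finite measures agreeing on them are equal. *)
Definition tuple_boxes : set (set (n.-tuple T)) :=
  [set tuple_box B | B in [set B | forall t, measurable (B t)]].

Lemma measurable_tuple_box B :
  (forall t, measurable (B t)) -> measurable (tuple_box B).
Proof.
move=> mB; rewrite (_ : tuple_box B =
    \bigcap_(t in [set: 'I_n]) ((@tnth n T ^~ t) @^-1` B t)).
  apply: fin_bigcap_measurable => // t _.
  by rewrite -[_ @^-1` _]setTI; exact: measurable_tnth.
by apply/seteqP; split => [x h t _|x h t]; exact: h.
Qed.

Lemma measurable_tuple_boxes : @measurable _ (n.-tuple T) = <<s tuple_boxes >>.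
Proof.
apply/seteqP; split.
  apply: smallest_sub; first exact: smallest_sigma_algebra.
  rewrite -bigcup_seq => A [i _ [C mC <-]]; apply: sub_gen_smallest.
  exists (fun t => if t == i then C else setT) => [t /=|].
    by case: ifP.
  apply/seteqP; split => [x /= h|x [_ h] t].
    by split => //; have := h i; rewrite eqxx.
  by case: eqP => [->|].
apply: smallest_sub; first exact: sigma_algebra_measurable.
by move=> _ [B mB <-]; exact: measurable_tuple_box.
Qed.

Lemma setI_closed_tuple_boxes : setI_closed tuple_boxes.
Proof.
move=> _ _ [B mB <-] [C mC <-]; exists (fun t => B t `&` C t) => [t|].
  exact: measurableI.
by apply/seteqP; split => [x h|x [h1 h2] t //]; split => t; case: (h t).
Qed.

Lemma tuple_boxesT : tuple_boxes setT.
Proof. by exists (fun=> setT) => //; apply/seteqP; split. Qed.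

End TupleBoxes.

Section Independence.
Context {R : realType} {d : measure_display} {Omega : measurableType d}.
Variable P : probability Omega R.

(** Both sides are finite measures in [E]: the law of [V] under [P] restricted to [D], and the law
    of [V] scaled by [P D]. Agreement on boxes therefore suffices. *)
Lemma independent_event_tuple (dT : measure_display) (T : measurableType dT)
    (k : nat) (V : Omega -> k.-tuple T) (D : set Omega) :
  measurable_fun setT V -> measurable D ->
  (forall B, tuple_boxes B -> P (V @^-1` B `&` D) = (P (V @^-1` B) * P D)%E) ->
  forall E, measurable E -> P (V @^-1` E `&` D) = (P (V @^-1` E) * P D)%E.
Proof.
move=> mV mD h E mE.
have PD0 : 0 <= fine (P D) by rewrite fine_ge0.
have PDE : (fine (P D))%:E = P D by rewrite fineK// fin_num_measure.
pose m1 : {measure set (k.-tuple T) -> \bar R} := pushforward (mrestr P mD) V.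
pose m2 : {measure set (k.-tuple T) -> \bar R} := mscale (NngNum PD0) (pushforward P V).
have m12 A : tuple_boxes A -> m1 mV A = m2 mV A.
  move=> bA; rewrite /m1 /m2 /= /mscale /= /pushforward /mrestr.
  by rewrite PDE muleC; exact: h.
have := @measure_unique _ R _ (@tuple_boxes _ T k) (fun=> setT)
  (measurable_tuple_boxes k) (@setI_closed_tuple_boxes _ _ k)
  (fun=> tuple_boxesT k) _ (m1 mV) (m2 mV) m12 _ E mE.
rewrite /m1 /m2 /= /mscale /= /pushforward /mrestr PDE muleC; apply.
  by apply/seteqP; split => // x _; exists 0%N.
by move=> _; rewrite preimage_setT setTI ltey_eq fin_num_measure.
Qed.

Section ProductExpectation.
Context {d1 d2 : measure_display} {T1 : measurableType d1} {T2 : measurableType d2}.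
Variables (V1 : Omega -> T1) (V2 : Omega -> T2).
Hypotheses (mV1 : measurable_fun setT V1) (mV2 : measurable_fun setT V2).
Hypothesis V12 : forall E1 E2, measurable E1 -> measurable E2 ->
  P (V1 @^-1` E1 `&` V2 @^-1` E2) = (P (V1 @^-1` E1) * P (V2 @^-1` E2))%E.

(** The joint law of [(V1, V2)] is the product of the marginal laws, since it has the right values
    on rectangles. Nonnegativity lets Tonelli replace any integrability condition. *)
Lemma expectation_mul_indep (F1 : T1 -> R) (F2 : T2 -> R) :
  measurable_fun setT F1 -> measurable_fun setT F2 ->
  (forall x, 0 <= F1 x) -> (forall x, 0 <= F2 x) ->
  (\int[P]_w (F1 (V1 w) * F2 (V2 w))%:E =
   \int[P]_w (F1 (V1 w))%:E * \int[P]_w (F2 (V2 w))%:E)%E.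
Proof.
move=> mF1 mF2 F10 F20.
have mV : measurable_fun setT (fun w => (V1 w, V2 w)) by exact: measurable_fun_pair.
pose V1m : {mfun Omega >-> T1} := HB.pack V1 (isMeasurableFun.Build _ _ _ _ V1 mV1).
pose V2m : {mfun Omega >-> T2} := HB.pack V2 (isMeasurableFun.Build _ _ _ _ V2 mV2).
pose Vm : {mfun Omega >-> (T1 * T2)%type} := HB.pack (fun w => (V1 w, V2 w))
  (isMeasurableFun.Build _ _ _ _ (fun w => (V1 w, V2 w)) mV).
pose m1 := distribution P V1m.
pose m2 := distribution P V2m.
pose mu := distribution P Vm.
have muE X : measurable X -> (m1 \x m2)%E X = mu X.
  by apply: product_measure_unique => A B mA mB; exact: V12.
pose F (z : T1 * T2) := (F1 z.1 * F2 z.2)%:E.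
have mF : measurable_fun setT F.
  apply/measurable_EFinP; apply: measurable_funM.
    exact: (measurableT_comp mF1).
  exact: (measurableT_comp mF2).
have F0 z : (0 <= F z)%E by rewrite lee_fin mulr_ge0.
transitivity (\int[mu]_z F z)%E.
  by rewrite /mu ge0_integral_pushforward.
rewrite (eq_measure_integral (m1 \x m2)%E); last first.
  by move=> A mA _; apply/esym; exact: muE.
rewrite fubini_tonelli1// /fubini_F /F /=.
rewrite (eq_integral (fun x => (F1 x)%:E * \int[m2]_y (F2 y)%:E)%E); last first.
  move=> x _; rewrite -ge0_integralZl//.
  - exact/measurable_EFinP.
  - by move=> y _; rewrite lee_fin.
  - by rewrite lee_fin.
rewrite ge0_integralZr//; last 3 first.
- exact/measurable_EFinP.
- by move=> x _; rewrite lee_fin.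
- by apply: integral_ge0 => x _; rewrite lee_fin.
rewrite /m1 /m2 !ge0_integral_pushforward//.
- exact/measurable_EFinP.
- by move=> x _; rewrite lee_fin.
- exact/measurable_EFinP.
- by move=> x _; rewrite lee_fin.
Qed.

End ProductExpectation.

Context {dT : measure_display} {T : measurableType dT}.

Lemma mutually_independent_comp (dU : measure_display) (U : measurableType dU)
    (N : nat) (W : 'I_N -> Omega -> T) (u : T -> U) :
  measurable_fun setT u -> mutually_independent P W ->
  mutually_independent P (fun i w => u (W i w)).
Proof.
move=> mu iW B mB.
have := iW (fun i => u @^-1` B i); apply => i.
by rewrite -[_ @^-1` _]setTI; exact: mu.
Qed.

Lemma mutually_independent_inj (N k : nat) (W : 'I_N -> Omega -> T)
    (idx : 'I_k -> 'I_N) : injective idx ->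
  mutually_independent P W -> mutually_independent P (fun t => W (idx t)).
Proof.
move=> idxi iW B mB.
(* Indices outside the range of [idx] receive the whole space, whose factor is 1. *)
pose C i := if [pick t | idx t == i] is Some t then B t else setT.
have Cidx t : C (idx t) = B t.
  rewrite /C; case: pickP => [t' /eqP/idxi->//|/(_ t)].
  by rewrite eqxx.
have Cn i : i \notin codom idx -> C i = setT.
  rewrite /C; case: pickP => // t /eqP <-.
  by rewrite codom_f.
have mC i : measurable (C i) by rewrite /C; case: pickP.
have := iW C mC.
rewrite (_ : \bigcap_(i in _) (W i @^-1` C i) =
    \bigcap_(t in [set: 'I_k]) (W (idx t) @^-1` B t)); last first.
  apply/seteqP; split => [w h t _|w h i _]; first by rewrite -Cidx; exact: h.
  have [/codomP[t ->]|/Cn->//] := boolP (i \in codom idx).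
  by rewrite Cidx; exact: h.
move=> ->.
rewrite (bigID (fun i => i \in codom idx)) /= [X in (_ * X)%E]big1; last first.
  by move=> i /Cn ->; rewrite preimage_setT probability_setT.
have uc : uniq (codom idx) by apply/injectiveP.
rewrite mule1 -(big_uniq _ uc) /= big_image /=.
by apply: eq_bigr => t _; rewrite Cidx.
Qed.

(** Mutual independence speaks of boxes only. The pi-system argument is applied twice, to pass from
    boxes to measurable sets first in one group and then in the other. *)
Lemma independent_split (k1 k2 : nat) (W : 'I_(k1 + k2) -> Omega -> T)
    (E1 : set (k1.-tuple T)) (E2 : set (k2.-tuple T)) :
  (forall i, measurable_fun setT (W i)) -> mutually_independent P W ->
  measurable E1 -> measurable E2 ->
  let V1 w := [tuple W (lshift k2 t) w | t < k1] in
  let V2 w := [tuple W (rshift k1 t) w | t < k2] in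
  P (V1 @^-1` E1 `&` V2 @^-1` E2) = (P (V1 @^-1` E1) * P (V2 @^-1` E2))%E.
Proof.
move=> mW iW mE1 mE2 V1 V2.
have mV1 : measurable_fun setT V1.
  apply/measurable_fun_tnthP => t.
  by rewrite (_ : _ \o _ = W (lshift k2 t))//; apply/funext => w /=; rewrite tnth_mktuple.
have mV2 : measurable_fun setT V2.
  apply/measurable_fun_tnthP => t.
  by rewrite (_ : _ \o _ = W (rshift k1 t))//; apply/funext => w /=; rewrite tnth_mktuple.
have mpre k (V : Omega -> k.-tuple T) E : measurable_fun setT V -> measurable E ->
    measurable (V @^-1` E).
  by move=> mV mE; rewrite -[_ @^-1` _]setTI; exact: mV.
apply: independent_event_tuple => // [|B1 bB1]; first exact: mpre.
have mB1 : measurable B1.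
  by case: bB1 => B mB <-; exact: measurable_tuple_box.
rewrite setIC muleC.
apply: independent_event_tuple => // [|B2 bB2]; first exact: mpre.
case: bB1 => B mB <-; case: bB2 => C mC <-.
have preE k (idx : 'I_k -> 'I_(k1 + k2)) (D : 'I_k -> set T) :
    (fun w => [tuple W (idx t) w | t < k]) @^-1` tuple_box D =
    \bigcap_(t in [set: 'I_k]) (W (idx t) @^-1` D t).
  apply/seteqP; split => [w h t _|w h t]; first by have := h t; rewrite tnth_mktuple.
  by rewrite tnth_mktuple; exact: h.
rewrite !preE (mutually_independent_inj (@lshift_inj _ _) iW)//.
rewrite (mutually_independent_inj (@rshift_inj _ _) iW)//.
pose D i := match fintype.split i with inl t => B t | inr t => C t end.
have mD i : measurable (D i) by rewrite /D; case: fintype.split.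
have Dl t : D (lshift k2 t) = B t by rewrite /D (unsplitK (inl t)).
have Dr t : D (rshift k1 t) = C t by rewrite /D (unsplitK (inr t)).
have := iW D mD; rewrite big_split_ord /=.
under eq_bigr do rewrite Dl.
under [X in (_ * X)%E]eq_bigr do rewrite Dr.
rewrite muleC => <-; congr (P _); apply/seteqP; split.
  move=> w [h2 h1] i _; case: (split_ordP i) => t ->; rewrite ?Dl ?Dr.
    exact: h1.
  exact: h2.
by move=> w h; split => t _; rewrite -?Dl -?Dr; exact: h.
Qed.

(** Joint injectivity of [idx] says that the groups are disjoint. The induction splits off the first
    group and packs all the others into one long tuple, so independence of two tuples is enough. *)
Lemma expectation_prod_groups_le (N k M : nat) (W : 'I_N -> Omega -> T)
    (idx : 'I_M -> 'I_k -> 'I_N) (phi : 'I_M -> k.-tuple T -> R) (c : R) :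
  (forall i, measurable_fun setT (W i)) -> mutually_independent P W ->
  injective (fun it : 'I_M * 'I_k => idx it.1 it.2) ->
  (forall i, measurable_fun setT (phi i)) -> (forall i x, 0 <= phi i x) -> 0 <= c ->
  (forall i, (\int[P]_w (phi i [tuple W (idx i t) w | t < k])%:E <= c%:E)%E) ->
  (\int[P]_w (\prod_(i < M) phi i [tuple W (idx i t) w | t < k])%:E <= (c ^+ M)%:E)%E.
Proof.
move=> mW iW; elim: M idx phi => [|M IH] idx phi idxi mphi phi0 c0 phic.
  under eq_integral do rewrite big_ord0.
  by rewrite integral_cst// mul1e expr0; exact: probability_le1.
pose K := #|{: 'I_M * 'I_k}|.
pose rest (u : 'I_K) : 'I_N := idx (lift ord0 (enum_val u).1) (enum_val u).2.
pose all (x : 'I_(k + K)) := match fintype.split x with inl t => idx ord0 t | inr u => rest u end.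
have alli : injective all.
  move=> x y; rewrite /all -{2}(splitK x) -{2}(splitK y).
  case: (fintype.split x) => a; case: (fintype.split y) => b /= h.
  - by have [->] := idxi (ord0, a) (ord0, b) h.
  - by have [] := idxi (ord0, a) (lift ord0 (enum_val b).1, (enum_val b).2) h.
  - by have [] := idxi (lift ord0 (enum_val a).1, (enum_val a).2) (ord0, b) h.
  - have h' := idxi (lift ord0 (enum_val a).1, (enum_val a).2)
      (lift ord0 (enum_val b).1, (enum_val b).2) h.
    have /lift_inj h1 := congr1 fst h'; have /= h2 := congr1 snd h'.
    by congr rshift; apply: enum_val_inj; apply/eqP; rewrite -pair_eqE /= h1 h2 !eqxx.
have iW' := mutually_independent_inj alli iW.
pose V1 w := [tuple W (all (lshift K t)) w | t < k].
pose V2 w := [tuple W (all (rshift k t)) w | t < K].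
pose F2 (x : K.-tuple T) : R := \prod_(i < M)
  phi (lift ord0 i) [tuple tnth x (enum_rank (i, t)) | t < k].
have V1E w : [tuple W (idx ord0 t) w | t < k] = V1 w.
  by apply: eq_from_tnth => t; rewrite !tnth_mktuple /all (unsplitK (inl t)).
have V2E i w : [tuple W (idx (lift ord0 i) t) w | t < k] =
    [tuple tnth (V2 w) (enum_rank (i, t)) | t < k].
  apply: eq_from_tnth => t; rewrite !tnth_mktuple /all.
  by rewrite (unsplitK (inr (enum_rank (i, t)))) /rest enum_rankK.
have mV1 : measurable_fun setT V1.
  apply/measurable_fun_tnthP => t.
  rewrite (_ : _ \o _ = W (all (lshift K t)))//.
  by apply/funext => w /=; rewrite tnth_mktuple.
have mV2 : measurable_fun setT V2.
  apply/measurable_fun_tnthP => t.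
  rewrite (_ : _ \o _ = W (all (rshift k t)))//.
  by apply/funext => w /=; rewrite tnth_mktuple.
have mF2 : measurable_fun setT F2.
  apply: measurable_prod => i _; apply: measurableT_comp => //.
  apply/measurable_fun_tnthP => t.
  rewrite (_ : _ \o _ = fun x => tnth x (enum_rank (i, t))); first exact: measurable_tnth.
  by apply/funext => w /=; rewrite tnth_mktuple.
have F20 x : 0 <= F2 x by apply: prodr_ge0.
under eq_integral do rewrite big_ord_recl V1E.
rewrite (eq_integral (fun w => (phi ord0 (V1 w) * F2 (V2 w))%:E)); last first.
  by move=> w _; congr (_ * _)%:E; apply: eq_bigr => i _; rewrite V2E.
rewrite (expectation_mul_indep mV1 mV2)//; last first.
  by move=> E1 E2 mE1 mE2; exact: (independent_split (fun i => mW (all i)) iW').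
rewrite exprS EFinM; apply: lee_pmul.
- by apply: integral_ge0 => w _; rewrite lee_fin.
- by apply: integral_ge0 => w _; rewrite lee_fin.
- by under eq_integral do rewrite -V1E; exact: phic.
rewrite (eq_integral (fun w =>
  (\prod_(i < M) phi (lift ord0 i) [tuple W (idx (lift ord0 i) t) w | t < k])%:E)); last first.
  by move=> w _; congr (_%:E); apply: eq_bigr => i _; rewrite V2E.
apply: (IH (fun i => idx (lift ord0 i)) (fun i => phi (lift ord0 i))) => //.
move=> x y /(idxi (lift ord0 x.1, x.2) (lift ord0 y.1, y.2)) h'.
have /lift_inj h1 := congr1 fst h'; have /= h2 := congr1 snd h'.
by apply/eqP; rewrite -pair_eqE /= h1 h2 !eqxx.
Qed.

End Independence.

Lemma expectation_prod_family_le (R : realType) (d dT : measure_display)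
    (Omega : measurableType d) (P : probability Omega R) (T : measurableType dT)
    (N k : nat) (I : finType) (W : 'I_N -> Omega -> T)
    (idx : I -> 'I_k -> 'I_N) (phi : k.-tuple T -> R) (c : R) :
  (forall i, measurable_fun setT (W i)) -> mutually_independent P W ->
  injective (fun it : I * 'I_k => idx it.1 it.2) ->
  measurable_fun setT phi -> (forall x, 0 <= phi x) -> 0 <= c ->
  (forall i, (\int[P]_w (phi [tuple W (idx i t) w | t < k])%:E <= c%:E)%E) ->
  (\int[P]_w (\prod_(i : I) phi [tuple W (idx i t) w | t < k])%:E <= (c ^+ #|I|)%:E)%E.
Proof.
move=> mW iW idxi mphi phi0 c0 phic.
under eq_integral do rewrite big_enum_val.
apply: (@expectation_prod_groups_le _ _ _ _ _ _ _ _ _ _ (fun i => idx (enum_val i))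
  (fun=> phi)) => //.
move=> x y /(idxi (enum_val x.1, x.2) (enum_val y.1, y.2)) h.
have /enum_val_inj h1 := congr1 fst h; have /= h2 := congr1 snd h.
by apply/eqP; rewrite -pair_eqE /= h1 h2 !eqxx.
Qed.

(** * Moment generating functions *)

(** For [x >= 0], the inequality [expR x <= 1 + x * expR x] is used twice. For [x < 0],
    [expR x <= 1 / (1 - x) <= 1 + x + x^2], because [(1 - x) * (1 + x + x^2) = 1 - x^3 >= 1]. *)
Lemma expR_le_quad (R : realType) (x : R) : expR x <= 1 + x + x ^+ 2 * expR `|x|.
Proof.
have [x0|x0] := leP 0 x.
  rewrite ger0_norm//.
  have h : expR x <= 1 + x * expR x.
    have := expR_ge1Dx (- x); rewrite -(ler_pM2r (expR_gt0 x)) -expRD addNr expR0.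
    by rewrite mulrDl mul1r; lra.
  apply: (le_trans h); rewrite -addrA lerD2l.
  by rewrite (le_trans (ler_wpM2l x0 h))// mulrDr mulr1 mulrA expr2.
rewrite ltr0_norm//.
have h1 := expR_ge1Dx (- x).
have h2 : expR x <= 1 + x + x ^+ 2.
  rewrite -[x in expR x]opprK expRN -ler_pV2 ?inE ?unitfE ?invr_gt0 ?invrK ?expR_gt0; last 2 first.
  - have : 0 < 1 + x + x ^+ 2 by rewrite expr2; nra.
    by move=> h; rewrite gt_eqF//= h.
  - by rewrite gt_eqF ?invr_gt0 ?expR_gt0//= invr_gt0 expR_gt0.
  apply: le_trans h1; have h : 0 < 1 + x + x ^+ 2 by rewrite expr2; nra.
  rewrite -[leLHS]mul1r ler_pdivrMr//.
  have -> : (1 - x) * (1 + x + x ^+ 2) = 1 + (- x) ^+ 3 by ring.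
  by rewrite lerDl exprn_ge0//; lra.
apply: (le_trans h2); rewrite lerD2l ler_peMr ?sqr_ge0//; lra.
Qed.

Lemma expRN_le_half (R : realType) (x : R) : 0 <= x -> x <= 1 -> expR (- x) <= 1 - x / 2.
Proof.
move=> x0 x1; have h := expR_ge1Dx x.
rewrite expRN -[leLHS]mul1r ler_pdivrMr ?expR_gt0//.
by apply: (@le_trans _ _ ((1 - x / 2) * (1 + x))); [nra|rewrite ler_wpM2l//; lra].
Qed.

(** The choice [e / (2 * C)] minimises [C * t^2 - t * e], with minimum [- e^2 / (4 * C)]. Returning
    from the exponential to [1 - x] costs another factor 2. *)
Lemma chernoff_rate (R : realType) (C e : R) : 0 < C -> 0 <= e -> e <= 1 -> e <= C ->
  (1 + C * (e / (2 * C)) ^+ 2) * expR (- (e / (2 * C) * e)) <= 1 - e ^+ 2 / (8 * C).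
Proof.
move=> C0 e0 e1 eC.
apply: (@le_trans _ _ (expR (- (e ^+ 2 / (4 * C))))).
  rewrite (_ : - (e ^+ 2 / (4 * C)) = C * (e / (2 * C)) ^+ 2 - e / (2 * C) * e).
    by rewrite expRD ler_wpM2r ?expR_ge0// expR_ge1Dx.
  by field; lra.
have -> : e ^+ 2 / (8 * C) = e ^+ 2 / (4 * C) / 2 by field; lra.
apply: expRN_le_half; first by rewrite divr_ge0 ?sqr_ge0// mulr_ge0// ltW.
by rewrite ler_pdivrMr ?mulr_gt0//; nra.
Qed.

(** Jensen's inequality, from the tangent to [expR] at the mean: the linear terms sum to zero. *)
Lemma expR_mean_le (R : realType) (I : finType) (x : I -> R) : (0 < #|I|)%N ->
  expR ((#|I|%:R)^-1 * \sum_i x i) <= (#|I|%:R)^-1 * \sum_i expR (x i).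
Proof.
move=> I0; set mu := (_ * \sum_i x i).
have I0' : 0 < #|I|%:R :> R by rewrite ltr0n.
rewrite ler_pdivlMl//.
apply: (@le_trans _ _ (\sum_i expR mu * (1 + (x i - mu)))).
  rewrite -mulr_sumr big_split sumrB /= !sumr_const.
  rewrite mulrC ler_wpM2l ?expR_ge0//.
  rewrite -[mu *+ _]mulr_natl /mu mulVKf ?gt_eqF//.
  by rewrite subrr addr0.
apply: ler_sum => i _; rewrite -[leRHS](_ : expR mu * expR (x i - mu) = _).
  by rewrite ler_wpM2l ?expR_ge0// expR_ge1Dx.
by rewrite -expRD addrC subrK.
Qed.

Section MomentGeneratingFunction.
Context {R : realType} {d : measure_display} {Omega : measurableType d}.
Variable P : probability Omega R.

(** This is an integrable majorant whose part affine in [x] has mean 1 when [x] has mean [th]. Half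
    of the exponential rate absorbs the square, through [u^2 / 2 <= expR u] at
    [u = kappa * |x - th| / 2], which gives the 8; the other half absorbs [expR |t * (x - th)|]. *)
Lemma expR_centered_le (kappa a t x th : R) :
  0 < kappa -> `|t| <= kappa / 2 -> `|th| <= a ->
  expR (t * (x - th)) <= 1 - t * th + t * x +
    t ^+ 2 * (8 / kappa ^+ 2 * expR (kappa * a)) * expR (kappa * `|x|).
Proof.
move=> k0 tk tha.
apply: (le_trans (expR_le_quad _)).
have -> : 1 + t * (x - th) = 1 - t * th + t * x by ring.
rewrite lerD2l exprMn -[leRHS]mulrA -[leLHS]mulrA ler_wpM2l ?sqr_ge0//.
set y := `|x - th|.
have y0 : 0 <= y by rewrite normr_ge0.
have h1 : (x - th) ^+ 2 <= 8 / kappa ^+ 2 * expR (kappa / 2 * y).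
  have ky : 0 <= kappa / 2 * y by rewrite mulr_ge0// divr_ge0// ltW.
  have := expR_ge1Dxn 1 ky; rewrite -[(x - th) ^+ 2]real_normK ?num_real// -/y => h.
  rewrite mulrAC ler_pdivlMr ?exprn_gt0//.
  by move: h; rewrite (_ : 2`!%:R = 2 :> R)// exprMn; nra.
have h2 : expR `|t * (x - th)| <= expR (kappa / 2 * y).
  by rewrite ler_expR normrM ler_wpM2r.
apply: (le_trans (ler_pM (sqr_ge0 _) (expR_ge0 _) h1 h2)).
rewrite -!mulrA ler_wpM2l// ler_wpM2l ?invr_ge0 ?sqr_ge0//.
rewrite -!expRD ler_expR.
have : y <= a + `|x|.
  by rewrite addrC; apply: (le_trans (ler_normB _ _)); rewrite lerD2l.
by move=> h; have := ler_wpM2l (ltW k0) h; lra.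
Qed.

Lemma mgf_centered_le (kappa K a t th : R) (xi : Omega -> R) :
  measurable_fun setT xi -> 0 < kappa -> `|t| <= kappa / 2 -> `|th| <= a ->
  (\int[P]_w (xi w)%:E = th%:E)%E ->
  (\int[P]_w (expR (kappa * `|xi w|))%:E <= K%:E)%E ->
  (\int[P]_w (expR (t * (xi w - th)))%:E <=
    (1 + 8 / kappa ^+ 2 * expR (kappa * a) * K * t ^+ 2)%:E)%E.
Proof.
move=> mxi k0 tk tha xith xiK.
set C := 8 / kappa ^+ 2 * expR (kappa * a).
have C0 : 0 <= C by rewrite mulr_ge0 ?divr_ge0 ?sqr_ge0 ?expR_ge0.
have mE : measurable_fun setT (fun w => (expR (kappa * `|xi w|))%:E).
  apply/measurable_EFinP; apply: measurableT_comp => //.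
  by apply: measurable_funM => //; exact: measurableT_comp.
have iE : P.-integrable setT (fun w => (expR (kappa * `|xi w|))%:E).
  apply/integrableP; split => //.
  under eq_integral do rewrite gee0_abs ?lee_fin ?expR_ge0//.
  by apply: (le_lt_trans xiK); rewrite ltry.
(* Integrability of [xi] follows from the exponential moment, as
   [kappa * |xi| <= expR (kappa * |xi|)]. *)
have iX : P.-integrable setT (fun w => (xi w)%:E).
  apply: (le_integrable measurableT (g := fun w => (kappa^-1)%:E * (expR (kappa * `|xi w|))%:E)%E).
  - exact/measurable_EFinP.
  - move=> w _; rewrite -EFinM !abse_EFin lee_fin.
    rewrite [leRHS]ger0_norm; last by rewrite mulr_ge0 ?expR_ge0// invr_ge0 ltW.
    by rewrite ler_pdivlMl// (le_trans _ (expR_ge1Dx _))// lerDr.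
  - exact: integrableZl.
pose f w := ((1 - t * th)%:E + t%:E * (xi w)%:E + (t ^+ 2 * C)%:E * (expR (kappa * `|xi w|))%:E)%E.
have i1 : P.-integrable setT (fun w => (1 - t * th)%:E + t%:E * (xi w)%:E)%E.
  apply: integrableD => //; last exact: integrableZl.
  exact: finite_measure_integrable_cst.
have i2 : P.-integrable setT (fun w => (t ^+ 2 * C)%:E * (expR (kappa * `|xi w|))%:E)%E.
  exact: integrableZl.
apply: (@le_trans _ _ (\int[P]_w f w)%E).
  apply: ge0_le_integral.
  - by [].
  - by move=> w _; rewrite lee_fin expR_ge0.
  - apply/measurable_EFinP; apply: measurableT_comp => //.
    by apply: measurable_funM => //; apply: measurable_funB.
  - by apply: (measurable_int P); exact: integrableD.
  - by move=> w _; rewrite /f -!EFinM -!EFinD lee_fin; exact: expR_centered_le.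
rewrite /f integralD// integralD//; last 2 first.
- exact: finite_measure_integrable_cst.
- exact: integrableZl.
rewrite integralZl// integralZl// xith integral_cst//.
rewrite [X in ((1 - t * th)%:E * X)%E](probability_setT P) mule1.
rewrite -EFinM -EFinD addrNK.
have := lee_wpmul2l (_ : (0 <= (t ^+ 2 * C)%:E)%E) xiK.
rewrite lee_fin mulr_ge0 ?sqr_ge0// => /(_ isT) h.
by apply: (le_trans (leeD2l _ h)); rewrite -EFinM -EFinD lee_fin lerD2l; nra.
Qed.

End MomentGeneratingFunction.

(** * Averaged U-statistics *)

Section AveragedUStatistic.
Context {R : realType} {d : measure_display} {Omega : measurableType d}.
Variables (N m n p : nat) (Y : 'I_N -> Omega -> R) (X : 'I_N -> Omega -> p.-tuple R).
Variable blk : 'I_N -> 'I_m.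
Hypotheses (m_gt0 : (0 < m)%N)
  (blk_card : forall l : 'I_m, #|[set i | blk i == l]%SET| = n).

Lemma exists_block_enum (l : 'I_m) : exists e : 'I_n -> 'I_N,
  [/\ injective e, forall x, blk (e x) == l & forall i, blk i == l -> exists x, e x = i].
Proof.
exists (fun x => enum_val (cast_ord (esym (blk_card l)) x)); split.
- by move=> x y /enum_val_inj/cast_ord_inj.
- by move=> x; have := enum_valP (cast_ord (esym (blk_card l)) x); rewrite inE.
- move=> i il; have iS : i \in [set i | blk i == l]%SET by rewrite inE.
  exists (cast_ord (blk_card l) (enum_rank_in iS i)).
  by rewrite cast_ordK enum_rankK_in.
Qed.

(* Hoeffding's decomposition: after relabelling each block by a permutation of
   ['I_n], cut its first [r * k] positions into [r] consecutive disjoint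
   [k]-tuples; averaging over the permutations recovers the U-statistic. *)
Lemma avg_U_perm_mean (k r : nat) : (0 < r)%N -> (r * k <= n)%N ->
  exists idx : {perm 'I_n} -> 'I_m * 'I_r -> 'I_k -> 'I_N,
  (forall s, injective (fun it : ('I_m * 'I_r) * 'I_k => idx s it.1 it.2)) /\
  forall (th : k.-tuple (R * R) -> R) (j : 'I_p) w, symmetric_kernel th ->
    avg_U n Y X blk th j w = (#|{perm 'I_n}|%:R)^-1 * \sum_(s : {perm 'I_n})
      ((m * r)%:R^-1 * \sum_i th [tuple Zobs Y X (idx s i t) j w | t < k]).
Proof.
move=> r0 rkn.
have [e he] := choice exists_block_enum.
have lt_f (q : 'I_r) (t : 'I_k) : (q * k + t < n)%N.
  apply: leq_trans rkn; apply: (@leq_trans (q.+1 * k)%N).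
    by rewrite mulSn addnC ltn_add2r.
  by rewrite leq_mul2r ltn_ord orbT.
pose f q t := Ordinal (lt_f q t).
have f_inj q q' t t' : f q t = f q' t' -> q = q' /\ t = t'.
  have k0 : (0 < k)%N by apply: leq_trans (ltn_ord t).
  move=> /(congr1 val) /= h; split; apply: val_inj => /=.
    by have := congr1 (divn^~ k) h; rewrite !divnMDl// !divn_small// !addn0.
  by have := congr1 (modn^~ k) h; rewrite !modnMDl !modn_small.
(* One permutation [s] relabels all blocks simultaneously: the blocks enter the mean linearly, so
   separate permutations would bring nothing more. *)
exists (fun s lq t => e lq.1 (s (f lq.2 t))); split.
  move=> s [[l q] t] [[l' q'] t'] /= h.
  have ll : l = l'.
    have [_ /(_ (s (f q t)))/eqP h1 _] := he l.
    have [_ /(_ (s (f q' t')))/eqP h2 _] := he l'.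
    by rewrite -h1 -h2 h.
  rewrite -ll in h *.
  have [ei _ _] := he l.
  by move: h => /ei/perm_inj/f_inj[-> ->].
move=> th j w thS.
have locE l q : local_U n Y X blk th j l w = (n`!%:R)^-1 *
    \sum_(s : {perm 'I_n}) th [tuple Zobs Y X (e l (s (f q t))) j w | t < k].
  have [ei eQ Qe] := he l.
  pose phi (g : {ffun 'I_k -> 'I_N}) := th [tuple Zobs Y X (g t) j w | t < k].
  have phiS g s : phi (perm_ffun g s) = phi g.
    rewrite /phi -[RHS](thS _ s); congr th; apply: eq_from_tnth => t.
    by rewrite !tnth_mktuple ffunE.
  have fi : injective (f q) by move=> t t' /f_inj[].
  rewrite /local_U (avg_sorted_avg_perm ei eQ Qe fi phiS).
  congr (_ * _); apply: eq_bigr => s _; congr th; apply: eq_from_tnth => t.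
  by rewrite !tnth_mktuple ffunE.
rewrite card_Sn /avg_U.
have r0' : r%:R != 0 :> R by rewrite pnatr_eq0 -lt0n.
have m0' : m%:R != 0 :> R by rewrite pnatr_eq0 -lt0n.
(* Each local U-statistic is written as the mean of [r] copies of itself; copy [q] is then expanded
   over permutations through the [q]-th tuple. *)
transitivity (m%:R^-1 * \sum_(l < m) (r%:R^-1 * \sum_(q < r) local_U n Y X blk th j l w)).
  congr (_ * _); apply: eq_bigr => l _.
  by rewrite sumr_const card_ord -[X in _ * X]mulr_natl mulKf.
pose A (s : {perm 'I_n}) l q := th [tuple Zobs Y X (e l (s (f q t))) j w | t < k].
transitivity (m%:R^-1 * (r%:R^-1 * (n`!%:R^-1 * \sum_l \sum_q \sum_s A s l q))).
  congr (_ * _); rewrite !mulr_sumr; apply: eq_bigr => l _.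
  rewrite !mulr_sumr; apply: eq_bigr => q _.
  by rewrite (locE l q).
rewrite -mulr_sumr natrM invfM (pair_big predT predT (fun l q => \sum_s A s l q)) /=.
by rewrite [\sum_(i : _ * _) _]exchange_big /= [RHS]mulrCA !mulrA.
Qed.

Section ExponentialBound.
Variables (P : probability Omega R) (k r : nat) (th : k.-tuple (R * R) -> R) (j : 'I_p).
Variables (kappa K a theta : R).
Hypotheses (r_gt0 : (0 < r)%N) (rk_le : (r * k <= n)%N).
Hypotheses (mY : forall i, measurable_fun setT (Y i))
  (mX : forall i, measurable_fun setT (X i)).
Hypothesis indepYX : mutually_independent P (fun i w => (Y i w, X i w)).
Hypotheses (mth : measurable_fun setT th) (thS : symmetric_kernel th).
Hypothesis th_mean : forall iota : 'I_k -> 'I_N, injective iota ->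
  (\int[P]_w (th [tuple Zobs Y X (iota t) j w | t < k])%:E = theta%:E)%E.
Hypothesis th_exp : forall iota : 'I_k -> 'I_N, injective iota ->
  (\int[P]_w (expR (kappa * `|th [tuple Zobs Y X (iota t) j w | t < k]|))%:E <= K%:E)%E.
Hypotheses (kappa_gt0 : 0 < kappa) (K_ge0 : 0 <= K) (theta_le : `|theta| <= a).

Let C := 8 / kappa ^+ 2 * expR (kappa * a) * K.
Let M := (m * r)%N.

Let C_ge0 : 0 <= C.
Proof. by rewrite /C !mulr_ge0 ?invr_ge0 ?sqr_ge0 ?expR_ge0. Qed.

Lemma measurable_Zobs i : measurable_fun setT (Zobs Y X i j).
Proof.
apply: measurable_fun_pair => //.
by apply: (@measurableT_comp _ _ _ _ _ _ (@tnth _ R ^~ j)) => //; exact: measurable_tnth.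
Qed.

Lemma measurable_kernel (iota : 'I_k -> 'I_N) :
  measurable_fun setT (fun w => th [tuple Zobs Y X (iota t) j w | t < k]).
Proof.
apply: measurableT_comp => //; apply/measurable_fun_tnthP => t.
rewrite (_ : _ \o _ = Zobs Y X (iota t) j); first exact: measurable_Zobs.
by apply/funext => w /=; rewrite tnth_mktuple.
Qed.

Lemma independent_Zobs : mutually_independent P (fun i => Zobs Y X i j).
Proof.
apply: (@mutually_independent_comp _ _ _ _ _ _ _ _ _
  (fun i w => (Y i w, X i w)) (fun yx => (yx.1, tnth yx.2 j))) => //.
apply: measurable_fun_pair => //.
by apply: (@measurableT_comp _ _ _ _ _ _ (@tnth _ R ^~ j)) => //; exact: measurable_tnth.
Qed.

Lemma measurable_avg_U : measurable_fun setT (avg_U n Y X blk th j).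
Proof.
apply: measurable_funM => //; apply: measurable_sum => l; apply: measurable_funM => //.
under eq_fun do rewrite -big_filter.
by apply: measurable_sum => f; exact: measurable_kernel.
Qed.

(** With the factor [M], each centred kernel value appears with exponent exactly [t], so the
    restriction on [t] does not depend on the sample size. *)
Lemma mgf_avg_U_le (t : R) : `|t| <= kappa / 2 ->
  (\int[P]_w (expR (t * (M%:R * (avg_U n Y X blk th j w - theta))))%:E
     <= ((1 + C * t ^+ 2) ^+ M)%:E)%E.
Proof.
move=> tk.
have [idx [idxi avgE]] := avg_U_perm_mean r_gt0 rk_le.
have M0 : M%:R != 0 :> R by rewrite pnatr_eq0 -lt0n muln_gt0 m_gt0.
pose G := #|{perm 'I_n}|.
have G0 : (0 < G)%N by rewrite /G card_Sn fact_gt0.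
have G0' : G%:R != 0 :> R by rewrite pnatr_eq0 -lt0n.
pose xi s i w := th [tuple Zobs Y X (idx s i t) j w | t < k].
pose psi (x : k.-tuple (R * R)) := expR (t * (th x - theta)).
have xiE s w : expR (\sum_i (t * (xi s i w - theta))) =
    \prod_i psi [tuple Zobs Y X (idx s i t) j w | t < k] by rewrite expR_sum.
have mpsi : measurable_fun setT psi.
  by apply: measurableT_comp => //; apply: measurable_funM => //; apply: measurable_funB.
have mxi s : measurable_fun setT (fun w => expR (\sum_i (t * (xi s i w - theta)))).
  apply: measurableT_comp => //; apply: measurable_sum => i.
  by apply: measurable_funM => //; apply: measurable_funB => //; exact: measurable_kernel.
have jensen w : expR (t * (M%:R * (avg_U n Y X blk th j w - theta))) <=
    G%:R^-1 * \sum_s expR (\sum_i (t * (xi s i w - theta))).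
  rewrite [leLHS](_ : _ = expR (G%:R^-1 * \sum_s \sum_i (t * (xi s i w - theta)))).
    exact: expR_mean_le.
  have avgE' : avg_U n Y X blk th j w = G%:R^-1 * \sum_s (M%:R^-1 * \sum_i xi s i w).
    exact: avgE.
  congr expR; rewrite avgE'.
  have -> : \sum_s \sum_i (t * (xi s i w - theta)) =
      t * (\sum_s \sum_i xi s i w - G%:R * (M%:R * theta)).
    rewrite [G%:R * _]mulr_natl -sumr_const -sumrB mulr_sumr; apply: eq_bigr => s _.
    rewrite -mulr_sumr sumrB sumr_const card_prod !card_ord -/M.
    by rewrite [M%:R * theta]mulr_natl.
  rewrite -mulr_sumr; move: M0 G0' (\sum_s _) => + +.
  move: (M%:R : R) (G%:R : R) => M' G' M0 G0' S.
  by field; rewrite M0 G0'.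
have c0 : 0 <= 1 + C * t ^+ 2 by rewrite addr_ge0// mulr_ge0// sqr_ge0.
have main s : (\int[P]_w (expR (\sum_i (t * (xi s i w - theta))))%:E <=
    ((1 + C * t ^+ 2) ^+ M)%:E)%E.
  under eq_integral do rewrite xiE.
  rewrite (_ : M = #|{: 'I_m * 'I_r}|); last by rewrite card_prod !card_ord.
  apply: (@expectation_prod_family_le _ _ _ _ P _ N k _ (fun i => Zobs Y X i j)
    (idx s) psi) => //.
  - exact: measurable_Zobs.
  - exact: independent_Zobs.
  - by move=> x; exact: expR_ge0.
  move=> i; apply: mgf_centered_le => //.
  - exact: measurable_kernel.
  - apply: th_mean => x y h.
    by have [] := idxi s (i, x) (i, y) h.
  - apply: th_exp => x y h.
    by have [] := idxi s (i, x) (i, y) h.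
apply: (@le_trans _ _ (\int[P]_w (G%:R^-1%:E *
    \sum_(s : {perm 'I_n}) (expR (\sum_i (t * (xi s i w - theta))))%:E))%E).
  apply: ge0_le_integral.
  - by [].
  - by move=> w _; rewrite lee_fin expR_ge0.
  - apply/measurable_EFinP; apply: measurableT_comp => //.
    apply: measurable_funM => //; apply: measurable_funM => //.
    by apply: measurable_funB => //; exact: measurable_avg_U.
  - under eq_fun do rewrite sumEFin -EFinM.
    apply/measurable_EFinP; apply: measurable_funM => //.
    exact: measurable_sum.
  - by move=> w _; rewrite sumEFin -EFinM lee_fin; exact: jensen.
have mxiE s : measurable_fun setT (fun w => (expR (\sum_i (t * (xi s i w - theta))))%:E).
  exact/measurable_EFinP.
have xi0 s w : (0 <= (expR (\sum_i (t * (xi s i w - theta))))%:E)%E.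
  by rewrite lee_fin expR_ge0.
rewrite ge0_integralZl; first last.
- by rewrite lee_fin invr_ge0.
- by move=> w _; apply: sume_ge0.
- exact: emeasurable_sum.
- by [].
rewrite ge0_integral_sum//.
rewrite lee_pdivrMl ?ltr0n//.
apply: (le_trans (lee_sum _ (fun s _ => main s))).
by rewrite sumEFin sumr_const -EFinM lee_fin mulr_natl.
Qed.

Section Tail.
Variable e : R.
Hypotheses (C_gt0 : 0 < C) (e_gt0 : 0 < e) (e_le1 : e <= 1) (e_leC : e <= C)
  (e_lekC : e <= kappa * C).

Lemma avg_U_upper_tail (sg : R) : `|sg| = 1 ->
  (P [set w | (e <= sg * (avg_U n Y X blk th j w - theta))%R] <=
   ((1 - e ^+ 2 / (8 * C)) ^+ M)%:E)%E.
Proof.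
move=> sg1.
have M0 : 0 < M%:R :> R by rewrite ltr0n muln_gt0 m_gt0.
pose V w := sg * (M%:R * (avg_U n Y X blk th j w - theta)).
have mV : measurable_fun setT V.
  apply: measurable_funM => //; apply: measurable_funM => //.
  by apply: measurable_funB => //; exact: measurable_avg_U.
pose Vm : {mfun Omega >-> R} := HB.pack V (isMeasurableFun.Build _ _ _ _ V mV).
(* The minimiser from [chernoff_rate]; [e_lekC] says exactly that it is at most [kappa / 2]. *)
pose t := e / (2 * C).
have C2 : 0 < 2 * C by rewrite mulr_gt0.
have C8 : 0 < 8 * C by rewrite mulr_gt0.
have t0 : 0 < t by rewrite divr_gt0.
have tk : `|sg * t| <= kappa / 2.
  rewrite normrM sg1 mul1r gtr0_norm// ler_pdivrMr//.
  by rewrite mulrA divfK ?pnatr_eq0.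
rewrite (_ : [set w | _] = [set w | M%:R * e <= Vm w]); last first.
  by apply/seteqP; split => w /=; rewrite /V mulrCA ler_pM2l.
apply: (le_trans (chernoff Vm (M%:R * e) t0)).
apply: (@le_trans _ _ (((1 + C * t ^+ 2) ^+ M)%:E * (expR (- (t * (M%:R * e))))%:E)%E).
  apply: lee_wpmul2r; first by rewrite lee_fin expR_ge0.
  rewrite /mmt_gen_fun unlock.
  have := mgf_avg_U_le tk.
  rewrite exprMn -[sg ^+ 2]real_normK ?num_real// sg1 expr1n mul1r.
  apply: le_trans; rewrite le_eqVlt; apply/orP; left; apply/eqP.
  by apply: eq_integral => w _ /=; rewrite /V mulrC mulrCA mulrA.
have -> : - (t * (M%:R * e)) = M%:R * - (t * e) by rewrite mulrN mulrCA.
rewrite -EFinM lee_fin expRM_natl -exprMn.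
apply: lerXn2r; last exact: (chernoff_rate C_gt0 (ltW e_gt0)).
- by rewrite nnegrE mulr_ge0 ?expR_ge0// addr_ge0// mulr_ge0 ?sqr_ge0.
- rewrite nnegrE subr_ge0 ler_pdivrMr// mul1r.
  have : e ^+ 2 <= C by rewrite expr2 (le_trans _ e_leC)// ler_piMr// ltW.
  by move: C_gt0; move: C => C'; lra.
Qed.

Lemma avg_U_tail :
  (P [set w | (e <= `|avg_U n Y X blk th j w - theta|)%R] <=
   (2 * (1 - e ^+ 2 / (8 * C)) ^+ M)%:E)%E.
Proof.
have mset sg : measurable [set w | (e <= sg * (avg_U n Y X blk th j w - theta))%R].
  rewrite -[X in measurable X]setTI; apply: measurable_fun_le => //.
  apply: measurable_funM => //; apply: measurable_funB => //; exact: measurable_avg_U.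
rewrite (_ : [set w | _] =
    [set w | (e <= 1 * (avg_U n Y X blk th j w - theta))%R] `|`
    [set w | (e <= -1 * (avg_U n Y X blk th j w - theta))%R]); last first.
  apply/seteqP; split => w /=; rewrite mul1r mulN1r ler_normr.
    by move/orP.
  by move=> h; apply/orP.
apply: (le_trans (measureU2 P (mset _) (mset _))).
rewrite mulr_natl mulr2n EFinD; apply: leeD; apply: avg_U_upper_tail.
  by rewrite normr1.
by rewrite normrN1.
Qed.

End Tail.

End ExponentialBound.

End AveragedUStatistic.

(** * Union bound and sure screening *)

Lemma le_measure_bigsetU_fin (d : measure_display) (T : measurableType d) (R : realType)
    (mu : {measure set T -> \bar R}) (I : finType) (Q : pred I) (A : I -> set T) :
  (forall i, measurable (A i)) ->
  measurable (\big[setU/set0]_(i | Q i) A i) /\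
  (mu (\big[setU/set0]_(i | Q i) A i) <= \sum_(i | Q i) mu (A i))%E.
Proof.
move=> mA; elim/big_rec2: _ => [|i x y _ [mx le_x]]; first by rewrite measure0.
split; first exact: measurableU.
by apply: (le_trans (measureU2 mu _ _)) => //; exact: leeD2l.
Qed.

Theorem theorem2 (R : realType) (s : nat) (kdeg : 'I_s -> nat) (g : gexpr s)
    (kappa0 K a b c tau : R) :
  0 < kappa0 -> 0 < a -> 0 < b -> 0 < c -> 0 < tau -> tau < 1 / 2 ->
  exists eta : R, 0 < eta /\
  forall (dO : measure_display) (Omega : measurableType dO)
    (P : probability Omega R) (N m n p : nat)
    (Y0 : Omega -> R) (X0 : Omega -> p.-tuple R)
    (Y : 'I_N -> Omega -> R) (X : 'I_N -> Omega -> p.-tuple R)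
    (blk : 'I_N -> 'I_m)
    (kern : 'I_p -> forall h : 'I_s, (kdeg h).-tuple (R * R) -> R)
    (theta : 'I_p -> 'I_s -> R),
  (* (Y_i, X_i), i < N, are i.i.d. copies of (Y0, X0) *)
  measurable_fun setT Y0 -> measurable_fun setT X0 ->
  (forall i, measurable_fun setT (Y i)) ->
  (forall i, measurable_fun setT (X i)) ->
  mutually_independent P (fun i w => (Y i w, X i w)) ->
  (forall i, same_law P (fun w => (Y i w, X i w)) (fun w => (Y0 w, X0 w))) ->
  (* partition of the N indices into m blocks S_l = blk^-1(l) of size n *)
  (0 < m)%N -> (0 < n)%N -> N = (m * n)%N ->
  (forall l : 'I_m, #|[set i | blk i == l]%SET| = n) ->
  (* symmetric measurable kernels, unbiased for theta *)
  (forall j h, measurable_fun setT (kern j h)) ->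
  (forall j h, symmetric_kernel (kern j h)) ->
  (forall j h (iota : 'I_(kdeg h) -> 'I_N), injective iota ->
     (\int[P]_w (kern j h [tuple Zobs Y X (iota t) j w | t < kdeg h])%:E
        = (theta j h)%:E)%E) ->
  (* (C1) *)
  (forall j h (iota : 'I_(kdeg h) -> 'I_N), injective iota ->
     (\int[P]_w
        (expR (kappa0 * `|kern j h [tuple Zobs Y X (iota t) j w | t < kdeg h]|))%:E
        <= K%:E)%E) ->
  (* (C2) *)
  (forall j h, `|theta j h| <= a) ->
  (forall j, gwell b g (theta j)) ->
  let Mset := [set j : 'I_p | `[< relevant P Y0 X0 j >]]%SET in
  (* (C3) *)
  (forall j, j \in Mset -> 2 * c * (N%:R `^ (- tau)) <= geval g (theta j)) ->
  let k := (\max_(h < s) kdeg h)%N in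
  (k <= n)%N ->
  let gamma := c * (N%:R `^ (- tau)) in
  ((1 - eta * (#|Mset|)%:R * (1 - N%:R `^ (- (2 * tau)) / eta) ^+ (m * (n %/ k)))%:E
    <= P [set w | forall j, j \in Mset ->
                  (gamma <= geval g (fun h => avg_U n Y X blk (kern j h) j w))%R])%E.
Proof.
move=> k0 a0 b0 c0 tau0 _.
have [A [L [del [A0 L0 del0 lipg]]]] := geval_lipschitz g a0 b0.
(* No sign is assumed for [K]; enlarging it makes [C] positive. *)
pose K1 := Num.max K 1.
have K10 : 0 < K1 by rewrite lt_max ltr01 orbT.
pose C := 8 / kappa0 ^+ 2 * expR (kappa0 * a) * K1.
have C0 : 0 < C by rewrite /C !mulr_gt0 ?invr_gt0 ?exprn_gt0 ?expR_gt0.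
(* [del] is the Lipschitz radius, [c / L] limits the error of [g] to [c * nu], and the last three
   caps are the hypotheses of the tail bound. *)
pose delta := Num.min (Num.min del (c / L)) (Num.min 1 (Num.min C (kappa0 * C))).
have delta0 : 0 < delta by rewrite !lt_min del0 ltr01 C0 divr_gt0// mulr_gt0.
have [ddel dcL d1 dC dkC] : [/\ delta <= del, delta <= c / L, delta <= 1,
    delta <= C & delta <= kappa0 * C].
  have : delta <= delta by [].
  by rewrite {2}/delta !le_min => /andP[/andP[-> ->] /and3P[-> -> ->]].
have C8 : 0 < 8 * C by rewrite mulr_gt0.
have q0 : 0 < 8 * C / delta ^+ 2 by rewrite divr_gt0// exprn_gt0.
(* [2 * s] counts two tails for each of [s] components, [8 * C / delta^2] matches the rate, and 1
   ensures positivity. *)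
pose eta := 1 + 2 * s%:R + 8 * C / delta ^+ 2.
have s0 : 0 <= s%:R :> R by [].
have eta1 : 1 <= eta by rewrite /eta; lra.
exists eta; split; first exact: lt_le_trans eta1.
move=> dO Omega P N m n p Y0 X0 Y X blk kern theta _ _ mY mX iYX _ m0 n0 NE blkn
  mkern kernS kernE kernK thetaa gw Mset C3 k kn.
lazy zeta; set nu := N%:R `^ (- tau) in C3 *; set gamma := c * nu.
have N0 : (0 < N)%N by rewrite NE muln_gt0 m0.
have nu0 : 0 < nu by apply: powR_gt0; rewrite ltr0n.
have nu1 : nu <= 1.
  by rewrite /nu -[leRHS](powRr0 N%:R); apply: ler_powR; rewrite ?ler1n// oppr_le0 ltW.
have nu2 : N%:R `^ (- (2 * tau)) = nu ^+ 2.
  by rewrite -powR_mulrn ?(ltW nu0)// /nu -powRrM mulNr mulrC.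
pose e := delta * nu.
have e0 : 0 < e by rewrite mulr_gt0.
have ed : e <= delta by rewrite ler_piMr// ltW.
pose U j h w := avg_U n Y X blk (kern j h) j w.
pose r := (n %/ k)%N.
pose q := 1 - e ^+ 2 / (8 * C).
have mU j h : measurable_fun setT (U j h).
  by apply: measurable_avg_U.
have tail j h : (P [set w | (e <= `|U j h w - theta j h|)%R] <= (2 * q ^+ (m * r))%:E)%E.
  (* As [0 < n] and [k <= n], [r = 0] forces [k = 0], division by 0 being 0. The power is then 1 and
     the bound 2 is trivial. *)
  have [r0|r0] := posnP r.
    rewrite r0 muln0 expr0 mulr1; apply: (@le_trans _ _ 1%E); last by rewrite lee_fin ler1n.
    apply: probability_le1; rewrite -[X in measurable X]setTI.
    apply: measurable_fun_le => //; apply: measurableT_comp => //.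
    exact: measurable_funB.
  apply: (@avg_U_tail _ _ _ N m n p Y X blk m0 blkn P _ r (kern j h) j
    kappa0 K1 a (theta j h)) => //.
  - apply: leq_trans (leq_divM n k); rewrite leq_mul2l; apply/orP; right.
    exact: leq_bigmax.
  - by move=> iota /kernE.
  - move=> iota /kernK => h1; apply: (le_trans (h1 j)).
    by rewrite lee_fin le_max lexx.
  - exact: ltW.
  - exact: le_trans d1.
  - exact: le_trans dC.
  - exact: le_trans dkC.
pose bad j := \big[setU/set0]_(h < s) [set w | (e <= `|U j h w - theta j h|)%R].
have mdev j h : measurable [set w | (e <= `|U j h w - theta j h|)%R].
  rewrite -[X in measurable X]setTI.
  apply: measurable_fun_le => //; apply: measurableT_comp => //.
  exact: measurable_funB.
have badP j := le_measure_bigsetU_fin P xpredT (mdev j).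
pose BAD := \big[setU/set0]_(j in Mset) bad j.
have BADP := le_measure_bigsetU_fin P (mem Mset) (fun j => (badP j).1).
set good := [set w | _].
have mgood : measurable good.
  rewrite (_ : good = \bigcap_(j in [set j | j \in Mset])
      [set w | (gamma <= geval g (fun h => U j h w))%R]).
    apply: fin_bigcap_measurable; first exact: finite_finset.
    move=> j _; rewrite -[X in measurable X]setTI.
    apply: measurable_fun_le => //.
    exact: (measurable_geval g (fun i => mU j i)).
  by [].
(* If all deviations are at most [e], then [g] moves by at most [L * e <= c * nu], and the margin
   [2 * c * nu] of (C3) leaves at least [gamma]. *)
have goodC : ~` good `<=` BAD.
  move=> w nw; apply: contrapT => nb; apply: nw => j jM.
  have dev h : `|U j h w - theta j h| <= e.
    rewrite leNgt; apply/negP => he; apply: nb.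
    rewrite /BAD (bigD1 j)//=; left.
    by rewrite /bad (bigD1 h)//=; left; exact: ltW.
  have [_ lg] := lipg (fun h => U j h w) (theta j) e (ltW e0) (le_trans ed ddel)
    (thetaa j) (gw j) dev.
  have h3 := C3 j jM.
  have h4 : L * e <= c * nu.
    by rewrite /e mulrA ler_wpM2r ?(ltW nu0)// mulrC -ler_pdivlMr.
  rewrite /gamma; move: lg; rewrite ler_distl => /andP[lg _].
  by move: h3 h4 lg; move: (geval _ _) (geval _ _) => x y; lra.
have q_ge0 : 0 <= q.
  rewrite subr_ge0 ler_pdivrMr// mul1r.
  have eC : e ^+ 2 <= C.
    by rewrite expr2 (le_trans _ (le_trans ed dC))// ler_piMr ?(le_trans ed d1)// ltW.
  by rewrite (le_trans eC)// ler_peMl ?(ltW C0)// ler1n.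
(* Here [e^2 / (8 * C) = nu^2 * delta^2 / (8 * C)], and [eta] exceeds [8 * C / delta^2]. *)
have qle : q <= 1 - nu ^+ 2 / eta.
  rewrite lerD2l lerN2 /e exprMn ler_pdivrMr ?(lt_le_trans ltr01)//.
  have -> : delta ^+ 2 * nu ^+ 2 / (8 * C) * eta = nu ^+ 2 * (delta ^+ 2 * ((8 * C)^-1 * eta)).
    by move: (_^-1) => ?; ring.
  rewrite ler_peMr ?sqr_ge0//.
  apply: (@le_trans _ _ (delta ^+ 2 * ((8 * C)^-1 * (8 * C / delta ^+ 2)))).
    by rewrite mulKf ?gt_eqF// mulfV// gt_eqF// exprn_gt0.
  rewrite ler_wpM2l ?sqr_ge0// ler_wpM2l ?invr_ge0 ?(ltW C8)//.
  by rewrite /eta lerDr addr_ge0// mulr_ge0.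
have PBAD : (P BAD <= (eta * #|Mset|%:R * (1 - nu ^+ 2 / eta) ^+ (m * r))%:E)%E.
  apply: (le_trans BADP.2).
  apply: (@le_trans _ _ (\sum_(j in Mset) (2 * s%:R * q ^+ (m * r))%:E)%E).
    apply: lee_sum => j _; apply: (le_trans (badP j).2).
    apply: (le_trans (lee_sum _ (fun h _ => tail j h))).
    rewrite sumEFin sumr_const card_ord lee_fin -[leLHS]mulr_natl.
    by rewrite mulrCA mulrA.
  rewrite sumEFin sumr_const lee_fin -[leLHS]mulr_natl mulrA [eta * _]mulrC.
  apply: ler_pM; rewrite ?exprn_ge0 ?mulr_ge0//.
    by rewrite ler_wpM2l// /eta; lra.
  by apply: lerXn2r => //; rewrite nnegrE// (le_trans q_ge0).
rewrite nu2 EFinB -[good]setCK probability_setC; last exact: measurableC.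
apply: leeB => //.
apply: le_trans PBAD; apply: le_measure.
- by apply/mem_set; exact: measurableC.
- by apply/mem_set; exact: BADP.1.
- exact: goodC.
Qed.
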